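(* (Domination principle.) Let $\mu$ and $\nu$ be positive and finite measures with closed supports in $\mathbb{C}$, which integrate the logarithm at infinity, and such that $$\nu(\mathbb{C})\le\mu(\mathbb{C})\qquad\text{and}\qquad I(\mu)<\infty.$$ Then, $$V^{\mu}(z)\le V^{\nu}(z)+C\quad \mu\text{-a.e.}\qquad\Longrightarrow\qquad V^{\mu}(z)\le V^{\nu}(z)+C,\quad z\in\mathbb{C},$$ where $C$ is some constant.
   Context: $V^{\sigma}(z)=-\int\log|z-t|\,d\sigma(t)$ is the logarithmic potential and $I(\sigma)=-\iint\log|z-t|\,d\sigma(z)\,d\sigma(t)$ the logarithmic energy of a measure $\sigma$. A measure $\sigma$ integrates the logarithm at infinity if $\int\log(1+|t|)\,d\sigma(t)<\infty$. The supports of the measures are possibly unbounded. *)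

(* Defs.v *)
From HB Require Import structures.
From mathcomp Require Import all_boot all_order all_algebra.
From mathcomp Require Import all_classical all_reals all_analysis.
From mathcomp Require Export complex.

Set Implicit Arguments.
Unset Strict Implicit.
Unset Printing Implicit Defensive.

Import Order.TTheory GRing.Theory Num.Theory.
Import numFieldNormedType.Exports.

Local Open Scope classical_set_scope.
Local Open Scope ring_scope.
Local Open Scope ereal_scope.

(* The complex plane with its Borel sigma-algebra; [R[i]^o] carries the
   topology of the modulus. *)
Notation borelC R := (g_sigma_algebraType (@open R[i]^o)).

(* [lne] rather than [ln]: [lne 0 = -oo], whereas [ln 0 = 0], which would hide
   the singularity of the kernel at [z = t]. *)
Definition log_dist (R : realType) (z t : R[i]) : \bar R :=
  lne (Normc.normc (z - t))%:E.

Definition log_potential (R : realType)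
    (sigma : {measure set (borelC R) -> \bar R}) (z : R[i]) : \bar R :=
  - \int[sigma]_t log_dist z t.

Definition log_energy (R : realType)
    (sigma : {measure set (borelC R) -> \bar R}) : \bar R :=
  - \int[sigma]_t \int[sigma]_z log_dist z t.

Definition integrates_log_at_infinity (R : realType)
    (sigma : {measure set (borelC R) -> \bar R}) : Prop :=
  \int[sigma]_t (ln (1 + Normc.normc (t : R[i])))%:E < +oo.

(* Main.v *)
Require Import Defs.
From HB Require Import structures.
From mathcomp Require Import all_boot all_order all_algebra.
From mathcomp Require Import all_classical all_reals all_analysis.
From mathcomp Require Import complex measurable_realfun.
From mathcomp Require Import ring lra.

(** Write [U^sigma] for the integral of [log |z - t|] against [sigma], so that
    [V^sigma = - U^sigma] and the claim is that [U^nu <= U^mu + C] mu-a.e. implies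
    the same inequality everywhere.

    The classical argument restricts [mu] to a compact set on which its potential
    is continuous and applies the maximum principle for subharmonic functions in
    the complement of that set.  Here the same idea is carried out for the
    potentials [U_s] of the regularised kernel [log (|z - t|^2 + s^2) / 2], which
    are finite, Lipschitz, and decrease to [U] as [s] tends to 0 ([spot_cvg]).

    - Finite energy makes [U^mu] finite mu-a.e. ([finite_energy_ae]).  Hence, for
      every [eta > 0], the inequalities [U^mu_s - U^mu <= eta] and
      [U^nu_s <= U^mu + C + eta] hold for some [s] on a bounded set [E] whose
      complement is as small as desired for [mu] ([exists_large_set]).

    - Continuity principle: the drop [U_s - U_d], for [mu] restricted to [E], is
      at any point at most 9 times what it is at an almost nearest point of [E]
      ([slog_drop_le]).  Being at most [eta] on [E], it is at most [9 * eta]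
      everywhere, uniformly in [d].  So the inequality between [U^nu_s] and the
      potential [U_d] of [mu] restricted to [E] extends, up to a multiple of
      [eta], to a neighbourhood of [E] ([comparison_near]).

    - Restricting [mu] loses mass, and at infinity the potentials compare like
      the masses.  The loss is repaired by adding [eta] times the restriction of
      [mu] to [E `&` B], where [B] is a fixed set of positive measure on which
      [U^mu_1 - U^mu] is bounded; its potential is bounded below independently of
      [E] ([spot_bounded_below]), so this costs another multiple of [eta].  The
      total mass now exceeds that of [nu], which settles a neighbourhood of
      infinity ([comparison_far]).

    - In between, the maximum principle is used with the Laplacian replaced by
      the average over the four neighbours at distance [d].  The product of the
      four values of [|w|^2 + s^2] is an explicit polynomial, which shows that the
      regularised kernel lies below its averages when [d <= s] ([sum4_slog_ge])
      and equals them up to [O(d^4)] away from its pole when [s = d]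
      ([sum4_slog_le]).  A small multiple of [|z|^2], whose averages gain [d^2],
      absorbs that error, and [discrete_maximum_principle] concludes
      ([comparison_everywhere]).

    Letting [eta] and then [s] tend to 0 gives the theorem ([spot_comparison] and
    [domination]). *)

Import Order.TTheory GRing.Theory Num.Theory.
Import numFieldNormedType.Exports.

Set Implicit Arguments.
Unset Strict Implicit.
Unset Printing Implicit Defensive.

Local Open Scope classical_set_scope.
Local Open Scope ring_scope.

Local Notation normc := Normc.normc.
Local Notation Re := complex.Re.
Local Notation Im := complex.Im.

Local Ltac nneg := repeat first [ by [] | by apply: ltW | by rewrite subr_ge0
  | exact: sqr_ge0 | apply: exprn_ge0 | apply: addr_ge0 | apply: mulr_ge0 ].

(** * The regularised logarithmic kernel *)

(** The logarithm smoothed at scale [s]: it decreases to [ln x] as [s] decreases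
    to 0, is bounded below by [ln s], and is [s^-1]-Lipschitz in [x]. *)
Definition slog (R : realType) (s x : R) : R := ln (x ^+ 2 + s ^+ 2) / 2.

Lemma slog_arg_gt0 (R : realType) (s x : R) : 0 < s -> 0 < x ^+ 2 + s ^+ 2.
Proof. by move=> s0; rewrite ltr_wpDl ?sqr_ge0 ?exprn_gt0. Qed.

Lemma ler_slog (R : realType) (s s' x x' : R) : 0 < s ->
  x ^+ 2 + s ^+ 2 <= x' ^+ 2 + s' ^+ 2 -> slog s x <= slog s' x'.
Proof.
move=> s0 le; have a0 := slog_arg_gt0 x s0.
by rewrite ler_pM2r ?invr_gt0// ler_ln ?posrE// (lt_le_trans a0).
Qed.

Lemma ln_sqr_half (R : realType) (x : R) : 0 < x -> ln (x ^+ 2) / 2 = ln x.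
Proof. by move=> x0; rewrite lnXn// mulr2n; field. Qed.

Lemma slog_ge_ln (R : realType) (s x y : R) : 0 < s -> 0 < y ->
  y ^+ 2 <= x ^+ 2 + s ^+ 2 -> ln y <= slog s x.
Proof.
move=> s0 y0 le; rewrite -ln_sqr_half// ler_pM2r ?invr_gt0//.
by rewrite ler_ln ?posrE ?exprn_gt0 ?slog_arg_gt0.
Qed.

Lemma slog_le_ln (R : realType) (s x y : R) : 0 < s -> 0 < y ->
  x ^+ 2 + s ^+ 2 <= y ^+ 2 -> slog s x <= ln y.
Proof.
move=> s0 y0 le; rewrite -(ln_sqr_half y0) ler_pM2r ?invr_gt0//.
by rewrite ler_ln ?posrE ?exprn_gt0 ?slog_arg_gt0.
Qed.

Lemma slog_lipschitz (R : realType) (s x y h : R) : 0 < s -> 0 <= x -> 0 <= y ->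
  x <= y + h -> 0 <= h -> slog s x <= slog s y + h / s.
Proof.
move=> s0 x0 y0 xy h0; have b0 := slog_arg_gt0 y s0.
have hs0 : 0 <= h / s by rewrite divr_ge0 // ltW.
have -> : slog s y + h / s = ln ((y ^+ 2 + s ^+ 2) * expR (h / s) ^+ 2) / 2.
  rewrite lnM ?posrE ?exprn_gt0 ?expR_gt0// lnXn ?expR_gt0// expRK /slog mulr2n.
  by field; rewrite gt_eqF.
rewrite ler_pM2r ?invr_gt0// ler_ln ?posrE ?slog_arg_gt0//; last first.
  by rewrite mulr_gt0 ?exprn_gt0 ?expR_gt0.
have e1 : 1 + h / s <= expR (h / s) by exact: expR_ge1Dx.
apply: (@le_trans _ _ ((y ^+ 2 + s ^+ 2) * (1 + h / s) ^+ 2)); last first.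
  by rewrite ler_pM2l// ler_sqr ?nnegrE ?addr_ge0 ?expR_ge0.
have hE : h = (h / s) * s by field; rewrite gt_eqF.
move: xy; rewrite {1}hE; set k := h / s in hs0 * => xy.
have : x ^+ 2 <= (y + k * s) ^+ 2.
  by rewrite ler_sqr ?nnegrE// ?addr_ge0// mulr_ge0// ltW.
have : 0 <= k * (y - s) ^+ 2 by rewrite mulr_ge0 ?sqr_ge0.
have : 0 <= k ^+ 2 * y ^+ 2 by rewrite mulr_ge0 ?sqr_ge0.
have : 0 <= k * (y ^+ 2 + s ^+ 2) by rewrite mulr_ge0 ?(ltW b0).
lra.
Qed.

Lemma bernoulli_le (R : realType) (q : R) (n : nat) : 0 <= q ->
  1 + n%:R * q <= (1 + q) ^+ n.
Proof.
move=> q0; elim: n => [|n IH]; first by rewrite mul0r addr0 expr0.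
rewrite exprS; apply: (@le_trans _ _ ((1 + q) * (1 + n%:R * q))); last first.
  by rewrite ler_wpM2l// addr_ge0.
have : 0 <= n%:R * q * q by rewrite !mulr_ge0.
rewrite -[in n.+1%:R]addn1 natrD; lra.
Qed.

(** This is the continuity principle at the level of kernels.  If [a] and [a'] are
    the distances from [t] to a point [z] and to an almost nearest point [z'] of a
    set containing [t], then [a' <= 2 * a + d], whence
    [a' ^+ 2 + d ^+ 2 <= 9 * (a ^+ 2 + d ^+ 2)].  The drop is half the logarithm of
    1 plus a quantity inversely proportional to [a ^+ 2 + d ^+ 2], and a factor 9
    comes out of such a logarithm by Bernoulli's inequality. *)
Lemma slog_drop_le (R : realType) (d s a a' : R) : 0 < d -> d <= s ->
  0 <= a -> 0 <= a' -> a' <= 2 * a + d ->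
  slog s a - slog d a <= 9 * (slog s a' - slog d a').
Proof.
move=> d0 ds a0 a'0 a'le; have s0 := lt_le_trans d0 ds.
have dropE x : slog s x - slog d x =
    ln (1 + (s ^+ 2 - d ^+ 2) / (x ^+ 2 + d ^+ 2)) / 2.
  have xd := slog_arg_gt0 x d0; have xs := slog_arg_gt0 x s0.
  rewrite /slog -mulrBl -ln_div ?posrE//; congr (ln _ / 2).
  by field; rewrite gt_eqF.
have sd : 0 <= s ^+ 2 - d ^+ 2 by rewrite subr_ge0 ler_sqr ?nnegrE// ltW.
have ad := slog_arg_gt0 a d0; have a'd := slog_arg_gt0 a' d0.
rewrite !dropE mulrA ler_pM2r ?invr_gt0//.
set q := (s ^+ 2 - d ^+ 2) / (a' ^+ 2 + d ^+ 2).
have q0 : 0 <= q by rewrite divr_ge0 ?(ltW a'd).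
apply: (@le_trans _ _ (ln ((1 + q) ^+ 9))); last first.
  by rewrite lnXn ?ltr_pwDl// mulr_natl.
rewrite ler_ln ?posrE; last 2 first.
- by rewrite ltr_pwDl// divr_ge0 ?(ltW ad).
- by rewrite exprn_gt0// ltr_pwDl.
apply: (@le_trans _ _ (1 + 9 * q)); last exact: bernoulli_le.
rewrite lerD2l /q mulrCA ler_wpM2l//.
rewrite -[leLHS]mul1r ler_pdivrMr// mulrAC ler_pdivlMr// mul1r.
have : a' ^+ 2 <= (2 * a + d) ^+ 2 by rewrite ler_sqr ?nnegrE// addr_ge0 ?mulr_ge0 ?(ltW d0).
by have := sqr_ge0 (a - d); have := sqr_ge0 a; have := sqr_ge0 d; lra.
Qed.

(** * Averages over four neighbours *)

Definition sum4 (R : realType) (f : R[i] -> R) (r : R) (z : R[i]) : R :=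
  f (z + (r +i* 0)%C) + f (z - (r +i* 0)%C)
  + f (z + (0 +i* r)%C) + f (z - (0 +i* r)%C).

Lemma sqr_normc (R : realType) (z : R[i]) :
  normc z ^+ 2 = Re z ^+ 2 + Im z ^+ 2.
Proof. by case: z => a b /=; rewrite sqr_sqrtr// addr_ge0 ?sqr_ge0. Qed.

Lemma normc_ge0 (R : realType) (z : R[i]) : 0 <= normc z.
Proof. by case: z => a b; exact: sqrtr_ge0. Qed.

(** The sum of four logarithms is the logarithm of a product, and the product over
    the four directions is a polynomial that can be compared with [b ^+ 4]. *)
Lemma sum4_slogE (R : realType) (s r : R) (w : R[i]) : 0 < s ->
  let b := Re w ^+ 2 + Im w ^+ 2 + s ^+ 2 in
  let p := (b ^+ 2 - r ^+ 4) ^+ 2 + 4 * r ^+ 2 * s ^+ 2 * (b + r ^+ 2) ^+ 2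
           + 16 * r ^+ 4 * (Re w * Im w) ^+ 2 in
  0 < p /\ sum4 (fun w => slog s (normc w)) r w = ln p / 2.
Proof.
move=> s0 b p; case: w @b @p => x y b p.
have P u v : 0 < u ^+ 2 + v ^+ 2 + s ^+ 2.
  by rewrite ltr_wpDl ?exprn_gt0// addr_ge0 ?sqr_ge0.
have pE : p = ((x + r) ^+ 2 + (y + 0) ^+ 2 + s ^+ 2)
    * ((x - r) ^+ 2 + (y - 0) ^+ 2 + s ^+ 2)
    * ((x + 0) ^+ 2 + (y + r) ^+ 2 + s ^+ 2)
    * ((x - 0) ^+ 2 + (y - r) ^+ 2 + s ^+ 2).
  by rewrite /p /b /=; ring.
split; first by rewrite pE !mulr_gt0.
rewrite /sum4 /slog !sqr_normc pE /=.
by rewrite !lnM ?posrE ?mulr_gt0//; field.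
Qed.

(** Discrete subharmonicity: with [r <= s] the positive term
    [4 * r ^+ 2 * s ^+ 2 * (b + r ^+ 2) ^+ 2] of the product outweighs the only
    negative one, [- 2 * r ^+ 4 * b ^+ 2]. *)
Lemma sum4_slog_ge (R : realType) (s r : R) (w : R[i]) : 0 < r -> r <= s ->
  4 * slog s (normc w) <= sum4 (fun w => slog s (normc w)) r w.
Proof.
move=> r0 rs; have s0 := lt_le_trans r0 rs.
have [] := sum4_slogE r w s0; set b := _ + s ^+ 2; set p := (X in 0 < X) => p0 ->.
have b0 : 0 < b by rewrite ltr_wpDl ?exprn_gt0// addr_ge0 ?sqr_ge0.
have -> : 4 * slog s (normc w) = ln (b ^+ 4) / 2.
  by rewrite /slog sqr_normc lnXn// mulrA mulr_natl.
rewrite ler_pM2r ?invr_gt0// ler_ln ?posrE ?exprn_gt0// /p.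
have : 0 <= 16 * r ^+ 4 * (Re w * Im w) ^+ 2.
  by nneg.
have rs2 : r ^+ 2 <= s ^+ 2 by rewrite ler_sqr ?nnegrE// ltW.
have r20 : 0 <= r ^+ 2 by exact: sqr_ge0.
have : 0 <= r ^+ 2 * (s ^+ 2 - r ^+ 2) * (b + r ^+ 2) ^+ 2.
  by nneg.
have : 0 <= r ^+ 6 * b by nneg.
have : 0 <= r ^+ 8 by rewrite exprn_ge0 ?(ltW r0).
have : 0 <= r ^+ 4 * b ^+ 2 by nneg.
lra.
Qed.

(** Discrete harmonicity away from the pole: when the smoothing scale equals the
    step [d], every term of the product other than [b ^+ 4] is of order
    [d ^+ 4 * b ^+ 2], and [b >= e ^+ 2].  An error of order 4 in [d] is what makes
    it negligible against the gain of order 2 of [|z| ^+ 2]. *)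
Lemma sum4_slog_le (R : realType) (d e : R) (w : R[i]) : 0 < d -> 0 < e ->
  e <= normc w ->
  sum4 (fun w => slog d (normc w)) d w <=
  4 * slog d (normc w) + 11 * (d / e) ^+ 4.
Proof.
move=> d0 e0 ew.
have [] := sum4_slogE d w d0; set b := _ + d ^+ 2; set p := (X in 0 < X) => p0 ->.
have b0 : 0 < b by rewrite ltr_wpDl ?exprn_gt0// addr_ge0 ?sqr_ge0.
have q0 : 0 <= (d / e) ^+ 4 by rewrite exprn_ge0// divr_ge0// ltW.
have d20 : 0 <= d ^+ 2 by exact: sqr_ge0.
have db : d ^+ 2 <= b by rewrite lerDr addr_ge0 ?sqr_ge0.
have eb : e ^+ 2 <= b.
  rewrite /b -sqr_normc (@le_trans _ _ (normc w ^+ 2)) ?lerDl//.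
  by rewrite ler_sqr ?nnegrE ?normc_ge0// ltW.
have xyb : 4 * (Re w * Im w) ^+ 2 <= b ^+ 2.
  have -> : 4 * (Re w * Im w) ^+ 2 = (2 * Re w * Im w) ^+ 2 by ring.
  have := sqr_ge0 (Re w + Im w); have := sqr_ge0 (Re w - Im w).
  move=> ? ?; rewrite -subr_ge0 subr_sqr /b.
  by rewrite mulr_ge0//; move: d20; lra.
have pb : p <= b ^+ 4 + 21 * d ^+ 4 * b ^+ 2.
  have H1 : 0 <= d ^+ 4 * (b ^+ 2 - 4 * (Re w * Im w) ^+ 2).
    by nneg.
  have H2 : 0 <= d ^+ 4 * (b - d ^+ 2) * (b + d ^+ 2).
    by nneg.
  have H3 : 0 <= d ^+ 4 * b * (b - d ^+ 2).
    by nneg.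
  have H4 : 0 <= d ^+ 4 * b ^+ 2.
    by nneg.
  by rewrite /p; move: H1 H2 H3 H4; lra.
have pb' : p <= b ^+ 4 * (1 + 21 * (d / e) ^+ 4).
  apply: (le_trans pb); rewrite mulrDr mulr1 lerD2l.
  have -> : 21 * d ^+ 4 * b ^+ 2 =
      (e ^+ 2) ^+ 2 * (21 * (d / e) ^+ 4 * b ^+ 2) by field; rewrite gt_eqF.
  have -> : b ^+ 4 * (21 * (d / e) ^+ 4) =
      b ^+ 2 * (21 * (d / e) ^+ 4 * b ^+ 2) by ring.
  apply: ler_wpM2r; first by nneg.
  by rewrite ler_sqr ?nnegrE ?sqr_ge0 ?(ltW b0).
have -> : 4 * slog d (normc w) = ln (b ^+ 4) / 2.
  by rewrite /slog sqr_normc lnXn// mulrA mulr_natl.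
have q1 : 0 < 1 + 21 * (d / e) ^+ 4 by apply: ltr_pwDl => //; nneg.
have : ln p <= ln (b ^+ 4) + ln (1 + 21 * (d / e) ^+ 4).
  by rewrite -lnM ?posrE ?exprn_gt0// ler_ln ?posrE ?mulr_gt0 ?exprn_gt0.
have : ln (1 + 21 * (d / e) ^+ 4) <= 21 * (d / e) ^+ 4.
  by apply: le_ln1Dx; rewrite (lt_le_trans _ (mulr_ge0 _ q0))// oppr_lt0.
by move: q0; lra.
Qed.

(** The maximum need not be attained: a point whose value is close enough to the
    supremum already has a neighbour above it. *)
Lemma discrete_maximum_principle (R : realType) (F : R[i] -> R)
    (D G : set R[i]) (r c K M : R) :
  0 < c -> (forall z, D z -> F z <= M) ->
  (forall z, D z -> G z -> F z <= K) ->
  (forall z, D z -> ~ G z ->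
     [/\ D (z + (r +i* 0)%C), D (z - (r +i* 0)%C),
         D (z + (0 +i* r)%C), D (z - (0 +i* r)%C)
       & 4 * F z + c <= sum4 F r z]) ->
  forall z, D z -> F z <= K.
Proof.
move=> c0 FM FK Fsub z Dz; rewrite leNgt; apply/negP => KF.
have supF : has_sup (F @` D) by split; [exists (F z), z|exists M => _ [y Dy <-]; exact: FM].
have ubS y : D y -> F y <= sup (F @` D).
  by move=> Dy; apply: (sup_upper_bound supF); exists y.
pose S := sup (F @` D).
have KS : K < S := lt_le_trans KF (ubS _ Dz).
pose e := Num.min (S - K) (c / 8).
have e0 : 0 < e by rewrite lt_min subr_gt0 KS/= divr_gt0.
have [_ [y Dy <-] Fy] := sup_adherent e0 supF.
have [eSK ec] : e <= S - K /\ e <= c / 8 by rewrite /e !ge_min !lexx orbT.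
have KFy : K < F y by move: Fy eSK; rewrite -/S; lra.
have nGy : ~ G y by move=> Gy; have := FK _ Dy Gy; rewrite leNgt KFy.
have [/ubS d1 /ubS d2 /ubS d3 /ubS d4] := Fsub _ Dy nGy.
by rewrite /sum4; move: Fy d1 d2 d3 d4 ec; rewrite -/S; lra.
Qed.

(** * Measurability on the Borel plane *)

Lemma normc_triangle (R : realType) (x y z : R[i]) :
  normc (x - z) <= normc (x - y) + normc (y - z).
Proof. by have := le_normcD (x - y) (y - z); rewrite addrA subrK. Qed.

Lemma normcBC (R : realType) (x y : R[i]) : normc (x - y) = normc (y - x).
Proof. by rewrite -normcN opprB. Qed.

(** Regularised kernels and potentials are Lipschitz for the modulus, so their
    strict superlevel sets are open. *)
Lemma lipschitz_measurable (R : realType) (f : R[i] -> R) (L : R) :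
  (forall x y, f x <= f y + L * normc (x - y)) ->
  measurable_fun setT (f : borelC R -> R).
Proof.
move=> fL; apply: (measurability _ (RGenOInfty.measurableE R)).
move=> _ [_ [c ->] <-]; rewrite setTI; apply: sub_gen_smallest.
rewrite /= openE => x; rewrite /= in_itv/= andbT => cx.
pose L1 := Num.max L 1; have L10 : 0 < L1 by rewrite lt_max ltr01 orbT.
have e0 : 0 < ((f x - c) / L1)%:C%C :> R[i].
  by rewrite ltcR divr_gt0// subr_gt0.
apply/nbhs_ballP; exists (((f x - c) / L1)%:C)%C => //= y.
rewrite -ball_normE /= in_itv/= andbT normc_def ltcR ltr_pdivlMr//.
have -> : Num.sqrt (Re (x - y) ^+ 2 + Im (x - y) ^+ 2) = normc (x - y).
  by case: (x - y).
move=> xy; have := fL x y.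
have : L * normc (x - y) <= normc (x - y) * L1.
  by rewrite mulrC ler_wpM2l ?normc_ge0// le_max lexx.
by move: xy; lra.
Qed.

Lemma normc_lipschitz (R : realType) (x y : R[i]) :
  normc x <= normc y + 1 * normc (x - y).
Proof. by have := normc_triangle x y 0; rewrite !subr0 mul1r addrC. Qed.

Lemma measurable_normc (R : realType) :
  measurable_fun setT (fun t : borelC R => normc (t : R[i])).
Proof. exact: (lipschitz_measurable (@normc_lipschitz R)). Qed.

Lemma slog_normc_lipschitz (R : realType) (s : R) (x y t : R[i]) : 0 < s ->
  slog s (normc (x - t)) <= slog s (normc (y - t)) + normc (x - y) / s.
Proof.
move=> s0; apply: slog_lipschitz; rewrite ?normc_ge0//.
by rewrite [leRHS]addrC normc_triangle.
Qed.

Lemma measurable_slog (R : realType) (s : R) (z : R[i]) : 0 < s ->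
  measurable_fun setT (fun t : borelC R => slog s (normc (z - (t : R[i])))).
Proof.
move=> s0; apply: (@lipschitz_measurable _ _ s^-1) => x y.
have := @slog_normc_lipschitz _ _ x y z s0.
by rewrite (normcBC z x) (normcBC z y) mulrC.
Qed.

Lemma measurable_log_infty (R : realType) :
  measurable_fun setT (fun t : borelC R => ln (1 + normc (t : R[i]))).
Proof.
by apply: measurableT_comp => //; apply: measurable_funD => //; exact: measurable_normc.
Qed.

Lemma log_infty_ge0 (R : realType) (t : R[i]) : 0 <= ln (1 + normc t).
Proof. by rewrite ln_ge0// lerDl normc_ge0. Qed.

Lemma slog_le_log_infty (R : realType) (s : R) (z t : R[i]) : 0 < s <= 1 ->
  slog s (normc (z - t)) <= ln (1 + normc z) + ln (1 + normc t).
Proof.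
move=> /andP[s0 s1]; have z0 := normc_ge0 z; have t0 := normc_ge0 t.
have pz : 0 < 1 + normc z by apply: ltr_pwDl.
have pt : 0 < 1 + normc t by apply: ltr_pwDl.
rewrite -lnM ?posrE//; apply: slog_le_ln; rewrite ?mulr_gt0//.
have zt : normc (z - t) <= normc z + normc t.
  by have := normc_triangle z 0 t; rewrite subr0 sub0r normcN.
have q : 0 <= normc (z - t) := normc_ge0 _.
apply: (@le_trans _ _ ((normc (z - t) + 1) ^+ 2)); first by nra.
by rewrite ler_sqr ?nnegrE; nra.
Qed.

Lemma ln_le_slog (R : realType) (s x : R) : 0 < s -> ln s <= slog s x.
Proof. by move=> s0; apply: slog_ge_ln => //; rewrite lerDr sqr_ge0. Qed.

(** * Potentials of the regularised kernel *)

(** This is the potential of the restriction of [sigma] to [D], with the sign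
    opposite to [log_potential]: it is close to [log |z|] times the mass at
    infinity. *)
Definition spot (R : realType) (sigma : {measure set (borelC R) -> \bar R})
    (D : set (borelC R)) (s : R) (z : R[i]) : R :=
  \int[sigma]_(t in D) slog s (normc (z - (t : R[i]))).

Section real_integrable.
Context d (T : measurableType d) (R : realType) (mu : {measure set T -> \bar R}).
Implicit Types (D : set T) (f g : T -> R).

Lemma integrableD_EFin D f g : measurable D ->
  mu.-integrable D (EFin \o f) -> mu.-integrable D (EFin \o g) ->
  mu.-integrable D (EFin \o (fun t => f t + g t)).
Proof. by move=> mD fi gi; exact: (integrableD mD fi gi). Qed.

Lemma integrableB_EFin D f g : measurable D ->
  mu.-integrable D (EFin \o f) -> mu.-integrable D (EFin \o g) ->
  mu.-integrable D (EFin \o (fun t => f t - g t)).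
Proof. by move=> mD fi gi; exact: (integrableB mD fi gi). Qed.

Lemma integrableZl_EFin D (k : R) f : measurable D ->
  mu.-integrable D (EFin \o f) ->
  mu.-integrable D (EFin \o (fun t => k * f t)).
Proof. by move=> mD fi; exact: (integrableZl mD k fi). Qed.

End real_integrable.

Section regularised_potential.
Context (R : realType) (sigma : {finite_measure set (borelC R) -> \bar R}).
Hypothesis log_sigma : integrates_log_at_infinity sigma.
Implicit Types (D : set (borelC R)) (s d e : R) (z : R[i]).

Let log_mass D : R := \int[sigma]_(t in D) ln (1 + normc (t : R[i])).

Lemma integrable_log_infty D : measurable D ->
  sigma.-integrable D (EFin \o (fun t => ln (1 + normc (t : R[i])))).
Proof.
move=> mD; apply: (@integrableS _ _ _ _ setT) => //; apply/integrableP; split.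
  by apply/measurable_EFinP; exact: measurable_log_infty.
under eq_integral => t _ do rewrite /= ger0_norm ?log_infty_ge0//.
exact: log_sigma.
Qed.

Lemma integrable_cst D (c : R) : measurable D ->
  sigma.-integrable D (EFin \o cst c).
Proof. by move=> mD; apply: finite_measure_integrable_cst. Qed.

Lemma integrable_slog D s z : measurable D -> 0 < s <= 1 ->
  sigma.-integrable D (EFin \o (fun t => slog s (normc (z - (t : R[i]))))).
Proof.
move=> mD s01; have /andP[s0 s1] := s01.
pose c : R := ln (1 + normc z) - ln s.
have := integrableD_EFin mD (integrable_cst c mD) (integrable_log_infty mD).
apply: le_integrable => //.
  apply/measurable_EFinP; apply: measurable_funTS; exact: measurable_slog.
move=> t _; rewrite /= lee_fin [leRHS]ger0_norm; last first.
  by rewrite addr_ge0 ?log_infty_ge0// subr_ge0 (le_trans (ln_le0 _))// log_infty_ge0.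
have := slog_le_log_infty z t s01; have := ln_le_slog (normc (z - t)) s0.
have := ln_le0 s1; have := log_infty_ge0 z; have := log_infty_ge0 t.
by rewrite ler_norml /c => *; apply/andP; split; lra.
Qed.

Lemma ler_spot D s d z : measurable D -> 0 < d -> d <= s -> s <= 1 ->
  spot sigma D d z <= spot sigma D s z.
Proof.
move=> mD d0 ds s1; have s0 := lt_le_trans d0 ds.
apply: le_Rintegral => //.
- by apply: integrable_slog; rewrite // d0 (le_trans ds).
- by apply: integrable_slog; rewrite // s0.
- by move=> t _; apply: ler_slog; rewrite // lerD2l ler_sqr ?nnegrE// ltW.
Qed.

Lemma spot_lipschitz D s z z' : measurable D -> 0 < s <= 1 ->
  spot sigma D s z <= spot sigma D s z' + fine (sigma D) / s * normc (z - z').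
Proof.
move=> mD s01; have /andP[s0 _] := s01.
rewrite mulrAC -mulrA mulrC -Rintegral_cst// -RintegralD//; last 2 first.
- exact: integrable_slog.
- exact: integrable_cst.
apply: le_Rintegral => //; first exact: integrable_slog.
- by apply: integrableD_EFin => //; [exact: integrable_slog|exact: integrable_cst].
- by move=> t _; exact: slog_normc_lipschitz.
Qed.

Lemma spot_setC D s z : measurable D -> 0 < s <= 1 ->
  spot sigma setT s z = spot sigma D s z + spot sigma (~` D) s z.
Proof.
move=> mD s01; rewrite /spot -(setUv D) Rintegral_setU//.
- exact: measurableC.
- by rewrite setUv; exact: integrable_slog.
- by rewrite disj_set2E setICr.
Qed.

(** The drop is the integral of a nonnegative kernel, hence monotone in the set,
    whereas [spot] itself is not. *)
Lemma spot_drop_subset D s d z : measurable D -> 0 < d -> d <= s -> s <= 1 ->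
  spot sigma D s z - spot sigma D d z <=
  spot sigma setT s z - spot sigma setT d z.
Proof.
move=> mD d0 ds s1; have s0 := lt_le_trans d0 ds.
rewrite !(@spot_setC D)// ?s0// ?d0 ?(le_trans ds)//.
have := @ler_spot (~` D) s d z (measurableC mD) d0 ds s1; lra.
Qed.

Lemma spot_upper D s z : measurable D -> 0 < s <= 1 ->
  spot sigma D s z <= fine (sigma D) * ln (1 + normc z) + log_mass D.
Proof.
move=> mD s01; rewrite mulrC -Rintegral_cst// -RintegralD//; last 2 first.
- exact: integrable_cst.
- exact: integrable_log_infty.
apply: le_Rintegral => //; first exact: integrable_slog.
- by apply: integrableD_EFin => //; [exact: integrable_cst|exact: integrable_log_infty].
- by move=> t _; exact: slog_le_log_infty.
Qed.

Lemma spot_lower D s z (c : R) : measurable D -> 0 < s <= 1 ->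
  (forall t, D t -> c <= slog s (normc (z - (t : R[i])))) ->
  fine (sigma D) * c <= spot sigma D s z.
Proof.
move=> mD s01 cle; rewrite mulrC -Rintegral_cst//.
by apply: le_Rintegral => //; [exact: integrable_cst|exact: integrable_slog].
Qed.

Lemma spot_lower_far D s z (N : R) : measurable D -> 0 < s <= 1 ->
  (forall t : R[i], D t -> normc t <= N) -> 2 * N + 1 <= normc z ->
  fine (sigma D) * (ln (1 + normc z) - ln 2) <= spot sigma D s z.
Proof.
move=> mD s01 DN zN; have /andP[s0 _] := s01; apply: spot_lower => // t Dt.
have z0 := normc_ge0 z; have p : 0 < 1 + normc z by rewrite ltr_pwDl.
rewrite -ln_div ?posrE//; apply: slog_ge_ln; rewrite ?divr_gt0//.
apply: (@le_trans _ _ (normc (z - t) ^+ 2)); last by rewrite lerDl sqr_ge0.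
have tz : normc z <= normc (z - t) + normc (t : R[i]).
  by have := normc_triangle z t 0; rewrite !subr0.
rewrite ler_sqr ?nnegrE ?normc_ge0// ?divr_ge0 ?(ltW p)//.
by have := DN _ Dt; lra.
Qed.

(** The continuity principle for potentials: it transfers a bound on the drop from
    the points [z'] of the set to all points [z] of the plane. *)
Lemma spot_drop_le D s d z z' : measurable D -> 0 < d -> d <= s -> s <= 1 ->
  (forall t : R[i], D t -> normc (z' - t) <= 2 * normc (z - t) + d) ->
  spot sigma D s z - spot sigma D d z <=
  9 * (spot sigma D s z' - spot sigma D d z').
Proof.
move=> mD d0 ds s1 zz'; have s01 : 0 < s <= 1 by rewrite s1 (lt_le_trans d0).
have d01 : 0 < d <= 1 by rewrite d0 (le_trans ds).
have i y r : 0 < r <= 1 -> sigma.-integrable D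
    (EFin \o (fun t => slog r (normc (y - (t : R[i]))))).
  exact: integrable_slog.
have iB y : sigma.-integrable D
    (EFin \o (fun t => slog s (normc (y - (t : R[i]))) - slog d (normc (y - (t : R[i]))))).
  by apply: integrableB_EFin; rewrite //; exact: i.
rewrite /spot -!RintegralB//; [|exact: i..].
rewrite -RintegralZl//; apply: le_Rintegral => //.
  exact: integrableZl_EFin.
by move=> t Dt; apply: slog_drop_le; rewrite ?normc_ge0//; exact: zz'.
Qed.

Lemma sum4_spotE D s r z : measurable D -> 0 < s <= 1 ->
  sigma.-integrable D (EFin \o (fun t =>
    sum4 (fun w => slog s (normc w)) r (z - (t : R[i])))) /\
  sum4 (spot sigma D s) r z =
  \int[sigma]_(t in D) sum4 (fun w => slog s (normc w)) r (z - (t : R[i])).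
Proof.
move=> mD s01.
have i y : sigma.-integrable D
    (EFin \o (fun t => slog s (normc (y - (t : R[i]))))).
  exact: integrable_slog.
have E t : sum4 (fun w => slog s (normc w)) r (z - t) =
   slog s (normc (z + (r +i* 0)%C - t)) + slog s (normc (z - (r +i* 0)%C - t))
   + slog s (normc (z + (0 +i* r)%C - t)) + slog s (normc (z - (0 +i* r)%C - t)).
  by rewrite /sum4 !(addrAC z (- t)).
under [in X in _ /\ X]eq_Rintegral do rewrite E.
under [X in EFin \o X]eq_fun do rewrite E.
have i2 := integrableD_EFin mD (i (z + (r +i* 0)%C)) (i (z - (r +i* 0)%C)).
have i3 := integrableD_EFin mD i2 (i (z + (0 +i* r)%C)).
by split; [exact: (integrableD_EFin mD i3 (i _))|rewrite !RintegralD].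
Qed.

Lemma spot_sum4_ge D s r z : measurable D -> 0 < s <= 1 -> 0 < r -> r <= s ->
  4 * spot sigma D s z <= sum4 (spot sigma D s) r z.
Proof.
move=> mD s01 r0 rs; have [i ->] := sum4_spotE r z mD s01.
have j := integrable_slog z mD s01.
rewrite -RintegralZl//; apply: le_Rintegral => //.
  exact: integrableZl_EFin.
by move=> t _; exact: sum4_slog_ge.
Qed.

Lemma spot_sum4_le D d e z : measurable D -> 0 < d <= 1 -> 0 < e ->
  (forall t : R[i], D t -> e <= normc (z - t)) ->
  sum4 (spot sigma D d) d z <=
  4 * spot sigma D d z + fine (sigma D) * (11 * (d / e) ^+ 4).
Proof.
move=> mD d01 e0 De; have /andP[d0 _] := d01.
have [i ->] := sum4_spotE d z mD d01.
have j := integrable_slog z mD d01.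
have j4 := integrableZl_EFin 4 mD j.
rewrite -RintegralZl// mulrC -Rintegral_cst// -RintegralD//; last first.
  exact: integrable_cst.
apply: le_Rintegral => //.
  by apply: integrableD_EFin => //; exact: integrable_cst.
by move=> t Dt; apply: sum4_slog_le => //; exact: De.
Qed.

End regularised_potential.

(** * Recovering the logarithmic potential *)

Lemma invS_itv (R : realType) n : 0 < (n.+1%:R^-1 : R) <= 1.
Proof. by rewrite invr_gt0 ltr0n invf_le1 ?ltr0n// ler1n. Qed.

Lemma le_invS (R : realType) m n : (m <= n)%N -> n.+1%:R^-1 <= m.+1%:R^-1 :> R.
Proof. by move=> mn; rewrite lef_pV2 ?posrE ?ltr0n// ler_nat. Qed.

Lemma near_invS_le (R : realType) (e : R) : 0 < e ->
  \forall n \near \oo, n.+1%:R^-1 <= e.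
Proof. by move=> e0; exact: (cvgr_le _ cvg_harmonic). Qed.

Lemma slog_cvg (R : realType) (x : R) : 0 <= x ->
  (slog n.+1%:R^-1 x)%:E @[n --> \oo] --> lne x%:E.
Proof.
move=> x0; have [xp|xn] := ltP 0 x; last first.
  have -> : x = 0 by apply/eqP; rewrite eq_le xn x0.
  rewrite (@le0_lneNy _ 0%:E)//; apply/cvgeNyPle => A.
  near=> n; rewrite lee_fin; have /andP[s0 _] := invS_itv R n.
  have -> : slog n.+1%:R^-1 0 = ln n.+1%:R^-1 :> R.
    by rewrite /slog expr0n add0r ln_sqr_half.
  rewrite -(expRK A) ler_ln ?posrE ?expR_gt0//.
  by near: n; apply: near_invS_le; exact: expR_gt0.
rewrite lne_EFin// -(ln_sqr_half xp); apply: cvg_EFin; first exact: nearW.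
rewrite /=; apply: cvgMl.
apply: (@continuous_cvg _ _ _ _ _ (fun n => x ^+ 2 + n.+1%:R^-1 ^+ 2) (@ln R)).
  by apply: continuous_ln; rewrite exprn_gt0.
rewrite -[X in _ --> X]addr0; apply: cvgD; first exact: cvg_cst.
rewrite -[X in _ --> X](mul0r 0).
exact: (cvgM (@cvg_harmonic R) (@cvg_harmonic R)).
Unshelve. all: by end_near. Qed.

(** Additivity of the integral when the subtracted function may have infinite
    integral: this occurs at the points where the potential is infinite. *)
Lemma integralB_ge0 d (T : measurableType d) (R : realType)
    (mu : {measure set T -> \bar R}) (h : T -> R) (g : T -> \bar R) :
  mu.-integrable setT (EFin \o h) -> measurable_fun setT g ->
  (forall t, 0 <= g t)%E ->
  (\int[mu]_t ((h t)%:E - g t) = \int[mu]_t (h t)%:E - \int[mu]_t g t)%E.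
Proof.
move=> ih mg g0.
have [gfin|] := ltP (\int[mu]_t g t)%E +oo%E.
  apply: integralB => //; apply/integrableP; split => //.
  by under eq_integral => t _ do rewrite gee0_abs//.
rewrite leye_eq => /eqP goo; rewrite goo.
have /fineK <- := integrable_fin_num measurableT ih.
rewrite addeNy integralE.
have mh : measurable_fun setT (fun t => (h t)%:E - g t)%E.
  by apply: emeasurable_funB => //; exact: measurable_int ih.
suff -> : (\int[mu]_t (fun t => (h t)%:E - g t)^\- t = +oo)%E by rewrite addeNy.
apply/eqP; rewrite -leye_eq.
have hp := integral_funepos_lt_pinfty measurableT ih.
rewrite leNgt; apply/negP => oo.
suff : (\int[mu]_t g t < +oo)%E by rewrite goo.
have := lte_add_pinfty oo hp; apply: le_lt_trans.
rewrite -ge0_integralD//; last 2 first.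
- exact: measurable_funeneg.
- by apply: measurable_funepos; exact: measurable_int ih.
apply: ge0_le_integral => //.
- apply: emeasurable_funD; first exact: measurable_funeneg.
  by apply: measurable_funepos; exact: measurable_int ih.
move=> t _; rewrite funenegE funeposE /=.
rewrite -leeBlDr; last by rewrite maxEge; case: ifP.
have [gt|gt] := eqVneq (g t) +oo%E.
  by rewrite gt addeNy /= maxye leey.
have gf : g t \is a fin_num by rewrite ge0_fin_numE// lt_neqAle gt leey.
rewrite -(fineK gf) -EFinB -!EFin_max lee_fin !le_max; apply/orP; left.
by rewrite opprB lerD2l lerN2 le_max lexx.
Qed.

Section potential_limit.
Context (R : realType) (sigma : {finite_measure set (borelC R) -> \bar R}).
Hypothesis log_sigma : integrates_log_at_infinity sigma.
Implicit Types (s : R) (z : R[i]).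

(** Monotone convergence, applied to the nonnegative increasing differences with
    the kernel smoothed at scale 1, which is integrable. *)
Lemma spot_cvg z : (spot sigma setT n.+1%:R^-1 z)%:E @[n --> \oo] -->
  (\int[sigma]_t log_dist z t)%E.
Proof.
pose h t : R := slog 1 (normc (z - t)).
pose k n t : R := slog n.+1%:R^-1 (normc (z - t)).
pose g n (t : borelC R) : \bar R := (h t - k n t)%:E.
have m1 : 0 < (1 : R) <= 1 by rewrite ltr01 lexx.
have mk n : measurable_fun setT (k n : borelC R -> R).
  by have /andP[s0 _] := invS_itv R n; exact: measurable_slog.
have mg n : measurable_fun setT (g n).
  apply/measurable_EFinP; apply: measurable_funB => //.
  exact: (measurable_slog z (ltr01)).
have g0 n t : (0 <= g n t)%E.
  rewrite lee_fin subr_ge0; have /andP[s0 s1] := invS_itv R n.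
  by apply: ler_slog => //; rewrite lerD2l ler_sqr ?nnegrE// ltW.
have ndg t : {homo g ^~ t : m n / (m <= n)%N >-> (m <= n)%E}.
  move=> m n mn; rewrite lee_fin lerD2l lerN2.
  have /andP[s0 s1] := invS_itv R m; have /andP[r0 r1] := invS_itv R n.
  by apply: ler_slog => //; rewrite lerD2l ler_sqr ?nnegrE ?le_invS// ltW.
have glim t : g ^~ t @ \oo --> ((h t)%:E - log_dist z t)%E.
  rewrite /g /=; under eq_fun do rewrite EFinB.
  apply: cvgeB; [by []|exact: cvg_cst|].
  by apply: slog_cvg; exact: normc_ge0.
have gl t : limn (g ^~ t) = ((h t)%:E - log_dist z t)%E by exact/cvg_lim.
have := @cvg_monotone_convergence _ _ _ sigma setT measurableT g mg
  (fun n t _ => g0 n t) (fun t _ => ndg t).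
under eq_integral do rewrite gl.
have G0 t : (0 <= (h t)%:E - log_dist z t)%E.
  by rewrite -gl; apply: lime_ge; [apply/cvg_ex; eexists; exact: glim|exact: nearW].
have mG : measurable_fun setT (fun t : borelC R => (h t)%:E - log_dist z t)%E.
  by apply: (emeasurable_fun_cvg g) => // t _; exact: glim.
have ih := integrable_slog log_sigma z measurableT m1.
have hfin := integrable_fin_num measurableT ih.
have -> : (\int[sigma]_t log_dist z t =
    (spot sigma setT 1 z)%:E - \int[sigma]_t ((h t)%:E - log_dist z t))%E.
  rewrite /spot /Rintegral fineK// -integralB_ge0//.
  by apply: eq_integral => t _; rewrite oppeB// addeA subee// add0e.
move=> gcvg.
have -> : (fun n => (spot sigma setT n.+1%:R^-1 z)%:E) = (fun n =>
    (spot sigma setT 1 z)%:E - \int[sigma]_(t in setT) g n t)%E.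
  apply/funext => n.
  have ik := integrable_slog log_sigma z measurableT (invS_itv R n).
  have -> : (\int[sigma]_(t in setT) g n t =
      (spot sigma setT 1 z - spot sigma setT n.+1%:R^-1 z)%:E)%E.
    rewrite -RintegralB// /Rintegral fineK//.
    by apply: integrable_fin_num => //; exact: integrableB_EFin.
  by rewrite -EFinB opprB addrC subrK.
by apply: cvgeB => //; exact: cvg_cst.
Qed.

Lemma potential_le_spot s z : 0 < s <= 1 ->
  (\int[sigma]_t log_dist z t <= (spot sigma setT s z)%:E)%E.
Proof.
move=> /andP[s0 s1]; rewrite -(cvg_lim _ (@spot_cvg z))//.
apply: lime_le; first by apply/cvg_ex; eexists; exact: spot_cvg.
near=> n; rewrite lee_fin; have /andP[r0 r1] := invS_itv R n.
by apply: ler_spot => //; near: n; exact: near_invS_le.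
Unshelve. all: by end_near. Qed.

Lemma near_spot_lt z (x : R) : (\int[sigma]_t log_dist z t < x%:E)%E ->
  \forall n \near \oo, spot sigma setT n.+1%:R^-1 z < x.
Proof.
move=> Ux; near=> n; rewrite -lte_fin; near: n.
exact: (@spot_cvg z _ (open_ereal_lt' Ux)).
Unshelve. all: by end_near. Qed.

End potential_limit.

(** * Exceptional sets of small measure *)

(** Absolute continuity of the integral along sets that almost every point
    eventually leaves; it serves to choose all exceptional sets. *)
Lemma Rintegral_vanishing d (T : measurableType d) (R : realType)
    (mu : {measure set T -> \bar R}) (f : T -> R) (D : (set T)^nat) (e : R) :
  0 < e -> mu.-integrable setT (EFin \o f) -> (forall n, measurable (D n)) ->
  {ae mu, forall x, \forall n \near \oo, ~ D n x} ->
  \forall n \near \oo, \int[mu]_(x in D n) f x < e.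
Proof.
move=> e0 fi mD aeD.
have mf := measurable_int mu fi.
have mfD n : measurable_fun setT ((EFin \o f) \_ (D n)).
  by apply/(measurable_restrictT _ _).1 => //; exact: measurable_funTS.
have lim0 : {ae mu, forall x, setT x ->
    (fun n => ((EFin \o f) \_ (D n)) x) @ \oo --> (0 : \bar R)%E}.
  apply: filterS aeD => x Dx _; apply: cvg_near_cst.
  by apply: filterS Dx => n nDx; rewrite patchE memNset.
have dom : {ae mu, forall x n, setT x ->
    (`|((EFin \o f) \_ (D n)) x| <= `|(EFin \o f) x|)%E}.
  by apply: aeW => x n _; rewrite patchE; case: ifP => // _; rewrite abse0.
have [_ _] := dominated_convergence measurableT mfD (measurable_cst 0%E) lim0
  (integrable_abse fi) dom.
rewrite integral0 => cvg0.
near=> n.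
have -> : \int[mu]_(x in D n) f x = fine (\int[mu]_x ((EFin \o f) \_ (D n)) x).
  by rewrite /Rintegral integral_mkcond.
have nfin : (\int[mu]_x ((EFin \o f) \_ (D n)) x)%E \is a fin_num.
  rewrite -integral_mkcond; apply: integrable_fin_num => //.
  exact: (@integrableS _ _ _ _ setT).
rewrite -lte_fin fineK//; near: n.
have /open_ereal_lt' : (0 < e%:E)%E by rewrite lte_fin.
exact: cvg0.
Unshelve. all: by end_near. Qed.

Lemma measurable_spot (R : realType) (sigma : {finite_measure set (borelC R) -> \bar R})
    (D : set (borelC R)) (s : R) : integrates_log_at_infinity sigma ->
  measurable D -> 0 < s <= 1 ->
  measurable_fun setT (fun z : borelC R => spot sigma D s (z : R[i])).
Proof.
move=> log_sigma mD s01; apply: lipschitz_measurable => x y.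
exact: spot_lipschitz.
Qed.

(** The energy is the integral of the potential, and the negative part of
    [\int[mu]_t log_dist z t] is integrable as soon as the energy is below [+oo]. *)
Lemma finite_energy_ae (R : realType)
    (mu : {finite_measure set (borelC R) -> \bar R}) :
  integrates_log_at_infinity mu -> (log_energy mu < +oo)%E ->
  {ae mu, forall z, -oo < \int[mu]_t log_dist z t}%E.
Proof.
move=> log_mu; rewrite /log_energy lteNl.
pose U (z : borelC R) := (\int[mu]_t log_dist (z : R[i]) t)%E.
have -> : (\int[mu]_t \int[mu]_z log_dist z t)%E = (\int[mu]_z U z)%E.
  apply: eq_integral => t _; apply: eq_integral => z _.
  by rewrite /log_dist normcBC.
have mU : measurable_fun setT U.
  apply: (emeasurable_fun_cvg (fun n (z : borelC R) =>
    (spot mu setT n.+1%:R^-1 (z : R[i]))%:E)).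
    move=> n; apply/measurable_EFinP.
    by apply: measurable_spot => //; exact: invS_itv.
  by move=> z _; exact: spot_cvg.
rewrite integralE => Uoo.
have Uneg : mu.-integrable setT U^\-%E.
  apply/integrableP; split; first exact: measurable_funeneg.
  under eq_integral => z _ do rewrite gee0_abs//.
  rewrite ltey; apply/eqP => oo; move: Uoo.
  by rewrite oo addeNy.
apply: filterS (integrable_ae measurableT Uneg) => z /(_ I) Uz.
rewrite ltNye; apply/eqP => Uz0; move: Uz; rewrite funenegE -/(U z).
by rewrite /U Uz0.
Qed.

(** * Comparison of regularised potentials *)

(** A point of [D] whose distance to [z] is within [d] of the infimum; the slack
    [d] dispenses with closedness of [D]. *)
Lemma almost_nearest (R : realType) (D : set R[i]) (z e0 : R[i]) (d : R) :
  0 < d -> D e0 ->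
  exists2 z', D z' & normc (z - z') <= normc (z - e0) + d /\
    forall t, D t -> normc (z' - t) <= 2 * normc (z - t) + d.
Proof.
move=> d0 De0.
have infD : has_inf ((fun t => normc (z - t)) @` D).
  by split; [exists (normc (z - e0)), e0|exists 0 => _ [t _ <-]; exact: normc_ge0].
have [_ [z' Dz' <-] z'lt] := inf_adherent d0 infD.
have le t : D t -> normc (z - z') <= normc (z - t) + d.
  move=> Dt; apply: (le_trans (ltW z'lt)); rewrite lerD2r.
  by apply: (inf_lbound infD.2); exists t.
exists z' => //; split; first exact: le.
move=> t Dt; have := normc_triangle z' z t; rewrite (normcBC z' z).
by have := le t Dt; lra.
Qed.

Section comparison.
Context (R : realType) (mu nu : {finite_measure set (borelC R) -> \bar R}).
Hypothesis log_mu : integrates_log_at_infinity mu.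
Hypothesis log_nu : integrates_log_at_infinity nu.
Variables (E B : set (borelC R)) (C N M eta s : R).
Hypotheses (mE : measurable E) (mB : measurable B).
Hypotheses (eta0 : 0 < eta) (s01 : 0 < s <= 1).
Hypothesis EN : forall z : R[i], E z -> normc z <= N.
Hypothesis E_drop : forall (z : R[i]) n, E z ->
  spot mu setT s z - spot mu setT n.+1%:R^-1 z <= eta.
Hypothesis E_le : forall (z : R[i]) n, E z ->
  spot nu setT s z <= spot mu setT n.+1%:R^-1 z + C + eta.
Hypothesis B_drop : forall (z : R[i]) n, B z ->
  spot mu setT 1 z - spot mu setT n.+1%:R^-1 z <= M.
Hypothesis E_large : fine (mu (~` E)) * ln (1 + N) +
  \int[mu]_(t in ~` E) ln (1 + normc (t : R[i])) <= eta.
Hypothesis mass_lt :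
  fine (nu setT) < fine (mu E) + eta * fine (mu (E `&` B)).
Hypothesis EB0 : E `&` B !=set0.

(* [F] carries the extra mass, with weight [eta]. *)
Let F := E `&` B.
Let mF : measurable F. Proof. exact: measurableI. Qed.
Let a := fine (mu E).
Let b := fine (mu F).
Let a0 : 0 <= a. Proof. exact: fine_ge0. Qed.
Let b0 : 0 <= b. Proof. exact: fine_ge0. Qed.
Let s0 : 0 < s. Proof. by case/andP: s01. Qed.
Let s1 : s <= 1. Proof. by case/andP: s01. Qed.

(** The kernel smoothed at scale 1 is nonnegative, so only the drop from scale 1
    matters; by the continuity principle it is controlled by its values on [B]. *)
Lemma spot_bounded_below n z : - (9 * M) <= spot mu F n.+1%:R^-1 z.
Proof.
have /andP[d0 d1] := invS_itv R n; set d := n.+1%:R^-1 in d0 d1 *.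
have [e0 Fe0] := EB0.
have [z' Fz' [_ z'near]] := almost_nearest z d0 Fe0.
have i1 : 0 < (1 : R) <= 1 by rewrite ltr01 lexx.
have := spot_drop_le log_mu mF d0 d1 (lexx _) z'near.
have := spot_drop_subset log_mu z' mF d0 d1 (lexx _).
have := @B_drop z' n Fz'.2; rewrite -/d.
have : 0 <= spot mu F 1 z.
  rewrite -(mulr0 b); apply: spot_lower => // t _.
  by rewrite -(ln1 R); apply: ln_le_slog.
lra.
Qed.

(** Move from [z] to an almost nearest point [z'] of [E], where the inequality is
    known, and back.  The cost is [9 * eta] for the drop at [z], [eta] for the two
    Lipschitz estimates together, [eta] for the mass of [mu] off [E], and [eta]
    for the inequality on [E] itself. *)
Lemma comparison_near n z e0 (rho : R) : n.+1%:R^-1 <= s -> n.+1%:R^-1 <= rho ->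
  (a + fine (nu setT)) / s * (2 * rho) <= eta ->
  E e0 -> normc (z - e0) <= rho ->
  spot nu setT s z <= spot mu E n.+1%:R^-1 z + C + 12 * eta.
Proof.
have /andP[d0 d1] := invS_itv R n; set d := n.+1%:R^-1 in d0 d1 *.
move=> ds drho rho_small Ee0 ze0.
have d01 : 0 < d <= 1 by rewrite d0.
have [z' Ez' [zz' z'near]] := almost_nearest z d0 Ee0.
have H1 := spot_drop_le log_mu mE d0 ds s1 z'near.
have H2 := spot_drop_subset log_mu z' mE d0 ds s1.
have H3 := @E_drop z' n Ez'; have H4 := @E_le z' n Ez'.
rewrite -/d in H3 H4.
have H5 := spot_lipschitz log_mu z' z mE s01.
have H6 := spot_lipschitz log_nu z z' measurableT s01.
have H7 := ler_spot log_mu z' mE d0 ds s1.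
have H8 := spot_setC log_mu z' mE d01.
have H9 := spot_upper log_mu z' (measurableC mE) d01.
have H10 : fine (mu (~` E)) * ln (1 + normc z') <= fine (mu (~` E)) * ln (1 + N).
  apply: ler_wpM2l; first exact: fine_ge0.
  rewrite ler_ln ?posrE ?lerD2l ?EN// ltr_pwDl ?normc_ge0//.
  exact: le_trans (normc_ge0 z') (EN Ez').
have H11 : (a + fine (nu setT)) / s * normc (z - z') <= eta.
  apply: le_trans rho_small; apply: ler_wpM2l; last by lra.
  by rewrite divr_ge0 ?(ltW s0)// addr_ge0// fine_ge0.
rewrite 2!mulrDl in H11; rewrite (normcBC z' z) -/a in H5.
move: E_large H1 H2 H3 H4 H5 H6 H7 H8 H9 H10 H11; lra.
Qed.

(** Both sides grow like [ln |z|] times the masses, and the mass on the right is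
    strictly larger. *)
Lemma comparison_far (K : R) : exists R0 : R, 0 <= R0 /\
  forall n z, R0 <= normc z -> spot nu setT s z <=
    spot mu E n.+1%:R^-1 z + eta * spot mu F n.+1%:R^-1 z + K.
Proof.
pose L := \int[nu]_(t in setT) ln (1 + normc (t : R[i])).
pose m := a + eta * b.
pose gap := m - fine (nu setT).
have gap0 : 0 < gap by rewrite subr_gt0.
pose X := (L + m * ln 2 - K) / gap.
exists (Num.max 0 (Num.max (2 * N + 1) (expR X))); split; first by rewrite le_max lexx.
move=> n z; rewrite !ge_max => /and3P[_ zN zX].
have i := invS_itv R n.
have H1 := spot_upper log_nu z measurableT s01.
have H2 := spot_lower_far log_mu mE i EN zN.
have FN t : F t -> normc (t : R[i]) <= N by move=> [Et _]; exact: EN.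
have H3 := spot_lower_far log_mu mF i FN zN.
have H4 : X <= ln (1 + normc z).
  rewrite -[X]expRK ler_ln ?posrE ?expR_gt0//; last first.
    by rewrite ltr_pwDl// normc_ge0.
  by apply: (le_trans zX); rewrite lerDr.
have H5 : L + m * ln 2 - K <= gap * ln (1 + normc z).
  by rewrite [leRHS]mulrC -ler_pdivrMr.
have H6 := ler_wpM2l (ltW eta0) H3.
move: H1 H2 H5 H6; rewrite -/L -/a -/b /gap /m; lra.
Qed.

(** The discrete maximum principle on the disc of radius [R0 + 1], where the good
    points are those near [E], handled by [comparison_near], and those of modulus
    at least [R0], handled by [comparison_far].  The step of the averages is the
    smoothing scale [d] of the potentials of [mu]. *)
Lemma comparison_everywhere : \forall n \near \oo, forall z,
  spot nu setT s z <=
    spot mu E n.+1%:R^-1 z + eta * spot mu F n.+1%:R^-1 z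
    + C + (13 + 9 * M) * eta.
Proof.
pose K := C + 12 * eta + 9 * M * eta.
have [R0 [R00 far]] := comparison_far K.
pose R1 := R0 + 1.
have R10 : 0 < R1 by rewrite ltr_wpDl.
pose eps := eta / R1 ^+ 2.
have eps0 : 0 < eps by rewrite divr_gt0// exprn_gt0.
have nu0 : 0 <= fine (nu setT) by exact: fine_ge0.
pose q := a + fine (nu setT) + 1.
have q0 : 0 < q by rewrite ltr_wpDl// addr_ge0.
pose rho := eta * s / (2 * q).
have rho0 : 0 < rho by rewrite divr_gt0 ?mulr_gt0//.
have rho_small : (a + fine (nu setT)) / s * (2 * rho) <= eta.
  have -> : (a + fine (nu setT)) / s * (2 * rho) =
    eta * ((a + fine (nu setT)) / q) by rewrite /rho; field; rewrite !gt_eqF.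
  rewrite -[leRHS]mulr1 ler_pM2l// ler_pdivrMr// mul1r /q lerDl ler01//.
pose m := a + eta * b.
have m0 : 0 <= m by rewrite addr_ge0// mulr_ge0// ltW.
(* [w] is the threshold below which the gain [4 * eps * d ^+ 2] of
   [eps * |z| ^+ 2] exceeds the fourth-order error of the averages by
   [eps * d ^+ 2]. *)
pose w := 3 * eps * rho ^+ 4 / (11 * m + 1).
have w0 : 0 < w.
  apply: divr_gt0; first by do ?[apply: mulr_gt0 => //]; exact: exprn_gt0.
  by rewrite ltr_wpDl// mulr_ge0.
near=> n; move=> z.
have i := invS_itv R n; have /andP[d0 d1] := i.
have ds : n.+1%:R^-1 <= s by near: n; exact: near_invS_le.
have drho : n.+1%:R^-1 <= rho by near: n; exact: near_invS_le.
have dw : n.+1%:R^-1 <= w by near: n; exact: near_invS_le.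
have {}far := far n; have below := spot_bounded_below n.
have near_E := @comparison_near n.
set d := n.+1%:R^-1 in i d0 d1 ds drho dw far below near_E *.
have [zR|zR] := leP R0 (normc z).
  by have := far z zR; rewrite /K; move: eta0; lra.
pose Q (y : R[i]) := spot nu setT s y - spot mu E d y - eta * spot mu F d y
  + eps * normc y ^+ 2.
pose D : set R[i] := [set y | normc y <= R1].
pose G : set R[i] := [set y | (exists2 e, E e & normc (y - e) <= rho) \/ R0 <= normc y].
have epsR y : D y -> 0 <= eps * normc y ^+ 2 <= eta.
  move=> Dy; rewrite mulr_ge0 ?sqr_ge0 ?(ltW eps0)//=.
  rewrite /eps -mulrA -[leRHS]mulr1 ler_pM2l// ler_pdivrMl ?exprn_gt0// mulr1.
  by rewrite ler_sqr ?nnegrE ?normc_ge0// ltW.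
suff QK : forall y, D y -> Q y <= K + eta.
  have Dz : D z by rewrite /D /= /R1; move: zR; lra.
  have /andP[+ _] := epsR z Dz; have := QK z Dz.
  by rewrite /Q /K; lra.
have step (t : R) : normc (t +i* 0)%C = `|t| /\ normc (0 +i* t)%C = `|t|.
  by rewrite /= expr0n /= addr0 add0r sqrtr_sqr.
have gain : fine (mu E) * (11 * (d / rho) ^+ 4) +
    eta * (fine (mu F) * (11 * (d / rho) ^+ 4)) + eps * d ^+ 2 <= 4 * eps * d ^+ 2.
  have : d ^+ 2 * (11 * m) <= 3 * eps * rho ^+ 4.
    move: dw; rewrite /w ler_pdivlMr; last by rewrite ltr_wpDl// mulr_ge0.
    apply: le_trans; rewrite expr2 -mulrA ler_pM2l//.
    have m110 : 0 <= 11 * m by rewrite mulr_ge0.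
    by rewrite -[leRHS]mul1r; apply: ler_pM => //; rewrite ?(ltW d0)// lerDl.
  have r4 : 0 < rho ^+ 4 by rewrite exprn_gt0.
  have -> : fine (mu E) * (11 * (d / rho) ^+ 4) +
    eta * (fine (mu F) * (11 * (d / rho) ^+ 4)) =
    d ^+ 2 * (d ^+ 2 * (11 * m) / rho ^+ 4).
    by rewrite /m /a /b; field; rewrite gt_eqF.
  rewrite -ler_pdivrMr// => H.
  have := ler_wpM2l (sqr_ge0 d) H; lra.
apply: (@discrete_maximum_principle _ Q D G d (eps * d ^+ 2) (K + eta)
  (fine (nu setT) * ln (1 + R1) + \int[nu]_(t in setT) ln (1 + normc (t : R[i]))
   - a * ln d + eta * (9 * M) + eta)).
- by rewrite mulr_gt0// exprn_gt0.
- move=> y Dy; have /andP[_ H1] := epsR y Dy.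
  have H2 := spot_upper log_nu y measurableT s01.
  have H3 : fine (nu setT) * ln (1 + normc y) <= fine (nu setT) * ln (1 + R1).
    apply: ler_wpM2l => //; rewrite ler_ln ?posrE ?lerD2l//.
    - by rewrite ltr_pwDl// normc_ge0.
    - by rewrite ltr_pwDl// ltW.
  have H4 : a * ln d <= spot mu E d y.
    by apply: spot_lower => // t _; exact: ln_le_slog.
  have H5 := ler_wpM2l (ltW eta0) (below y).
  by move: H1 H2 H3 H4 H5; rewrite /Q; lra.
- move=> y Dy Gy; have /andP[_ H1] := epsR y Dy.
  have H2 := ler_wpM2l (ltW eta0) (below y).
  case: Gy => [[e Ee ye]|Ry].
    have H3 := near_E y e rho ds drho rho_small Ee ye.
    by move: H1 H2 H3; rewrite /Q /K; lra.
  by have H3 := far y Ry; move: H1 H3; rewrite /Q; lra.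
- move=> y Dy nGy.
  have yR : normc y < R0 by rewrite ltNge; apply/negP => Ry; apply: nGy; right.
  have yE t : E t -> rho <= normc (y - t).
    by move=> Et; rewrite leNgt; apply/negP => yt; apply: nGy;
    left; exists t => //; exact: ltW.
  have yF t : F t -> rho <= normc (y - t) by move=> [/yE].
  have nb u : normc u <= 1 -> D (y + u).
    by move=> u1; rewrite /D /= /R1; have := le_normcD y u; move: yR; lra.
  have nd : `|d| <= 1 by rewrite gtr0_norm.
  split.
  + by apply: nb; rewrite (step d).1.
  + by apply: nb; rewrite normcN (step d).1.
  + by apply: nb; rewrite (step d).2.
  + by apply: nb; rewrite normcN (step d).2.
  have sumQ : sum4 Q d y = sum4 (spot nu setT s) d y - sum4 (spot mu E d) d y
      - eta * sum4 (spot mu F d) d y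
      + eps * (4 * normc y ^+ 2 + 4 * d ^+ 2).
    have -> : 4 * normc y ^+ 2 + 4 * d ^+ 2 = sum4 (fun u => normc u ^+ 2) d y.
      by rewrite /sum4 !sqr_normc; case: (y) => u v /=; ring.
    by rewrite /sum4 /Q; ring.
  have H1 := spot_sum4_ge log_nu y measurableT s01 d0 ds.
  have H2 := spot_sum4_le log_mu mE i rho0 yE.
  have H3 := spot_sum4_le log_mu mF i rho0 yF.
  have H4 := ler_wpM2l (ltW eta0) H3.
  by rewrite sumQ; move: H1 H2 H4 gain; rewrite /Q; lra.
Unshelve. all: by end_near. Qed.

End comparison.

(** * Choice of the sets and conclusion *)

Lemma measurable_le_set d (T : measurableType d) (R : realType) (f g : T -> R) :
  measurable_fun setT f -> measurable_fun setT g ->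
  measurable [set x | f x <= g x].
Proof.
move=> mf mg; have := measurable_fun_ler mf mg measurableT (Y := [set true]).
by rewrite setTI; apply.
Qed.

Lemma fine_measureC d (T : measurableType d) (R : realType)
    (mu : {finite_measure set T -> \bar R}) (A : set T) : measurable A ->
  fine (mu setT) = fine (mu A) + fine (mu (~` A)).
Proof.
move=> mA; have mAC := measurableC mA.
by rewrite -fineD ?fin_num_measure// -measureU ?setUv ?setICr.
Qed.

Lemma fine_measure_le_setI d (T : measurableType d) (R : realType)
    (mu : {finite_measure set T -> \bar R}) (A B : set T) :
  measurable A -> measurable B ->
  fine (mu B) <= fine (mu (A `&` B)) + fine (mu (~` A)).
Proof.
move=> mA mB; have mAC := measurableC mA; have mAB := measurableI _ _ mA mB.
rewrite -fineD ?fin_num_measure// fine_le ?fin_numD ?fin_num_measure//.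
apply: (@le_trans _ _ (mu ((A `&` B) `|` (~` A)))); last exact: measureU2.
apply: le_measure; rewrite ?inE//; first exact: measurableU.
by move=> x Bx; have [Ax|nAx] := pselect (A x); [left|right].
Qed.

Section domination.
Context (R : realType) (mu nu : {finite_measure set (borelC R) -> \bar R}).
Variable C : R.
Hypothesis log_mu : integrates_log_at_infinity mu.
Hypothesis log_nu : integrates_log_at_infinity nu.
Hypothesis mu_gt0 : (0 < mu setT)%E.
Hypothesis nu_le_mu : (nu setT <= mu setT)%E.
Hypothesis ae_le : {ae mu, forall z,
  (-oo < \int[mu]_t log_dist z t)%E /\
  (\int[nu]_t log_dist z t <= \int[mu]_t log_dist z t + C%:E)%E}.

Lemma potential_real (z : R[i]) : (-oo < \int[mu]_t log_dist z t)%E ->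
  exists2 u, (\int[mu]_t log_dist z t = u%:E)%E &
    forall n, u <= spot mu setT n.+1%:R^-1 z.
Proof.
move=> Uz; have le n := potential_le_spot log_mu z (invS_itv R n).
move: Uz (le); case: (\int[mu]_t log_dist z t)%E => [u _ {}le|//_ /(_ 0%N)|//].
  by exists u => // n; rewrite -lee_fin.
by rewrite leye_eq.
Qed.

Let drop_set (s M : R) : set (borelC R) :=
  [set z | forall n, spot mu setT s (z : R[i]) - spot mu setT n.+1%:R^-1 z <= M].

Let le_set (s eta : R) : set (borelC R) := [set z | forall n,
  spot nu setT s (z : R[i]) <= spot mu setT n.+1%:R^-1 z + C + eta].

Let measurable_drop_set s M : 0 < s <= 1 -> measurable (drop_set s M).
Proof.
move=> s01.
have -> : drop_set s M = \bigcap_n [set z : borelC R |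
    spot mu setT s (z : R[i]) - spot mu setT n.+1%:R^-1 z <= M].
  by apply/seteqP; split => z; [move=> H n _; exact: H|move=> H n; exact: H].
apply: bigcapT_measurable => n; apply: measurable_le_set => //.
by apply: measurable_funB; apply: measurable_spot => //; exact: invS_itv.
Qed.

Let measurable_le_set_potential s eta : 0 < s <= 1 -> measurable (le_set s eta).
Proof.
move=> s01.
have -> : le_set s eta = \bigcap_n [set z : borelC R |
    spot nu setT s (z : R[i]) <= spot mu setT n.+1%:R^-1 z + C + eta].
  by apply/seteqP; split => z; [move=> H n _; exact: H|move=> H n; exact: H].
apply: bigcapT_measurable => n; apply: measurable_le_set.
  exact: measurable_spot.
do 2![apply: measurable_funD => //].
by apply: measurable_spot => //; exact: invS_itv.
Qed.

(** The set with bounded drop is found once and for all, before [eta]: its bound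
    [M] and its measure must not depend on the set [E] of [exists_large_set]. *)
Lemma exists_bounded_drop : exists M : R,
  0 < fine (mu (drop_set 1 M)).
Proof.
have i1 : 0 < (1 : R) <= 1 by rewrite ltr01 lexx.
have mD n := measurable_drop_set n%:R i1.
have m0 : 0 < fine (mu setT) by rewrite fine_gt0// mu_gt0 ltey_eq fin_num_measure.
have aeD : {ae mu, forall z, \forall n \near \oo, ~ (~` drop_set 1 n%:R) z}.
  apply: (@filterS _ _ (ae_filter_ringOfSetsType mu) _ _ _ ae_le)
    => z [/potential_real[u _ ule] _].
  near=> n; apply; move=> k; apply: (@le_trans _ _ (spot mu setT 1 z - u)).
    by rewrite lerD2l lerN2.
  by near: n; exact: nbhs_infty_ger.
have := Rintegral_vanishing m0 (integrable_cst mu 1 measurableT)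
  (fun n => measurableC (mD n)) aeD.
case=> n _ /(_ n (leqnn n)) /=.
rewrite Rintegral_cst ?mul1r; last exact: measurableC.
rewrite (fine_measureC mu (mD n)) ltrDr => H.
by exists n%:R.
Unshelve. all: by end_near. Qed.

(** The radius [N] is chosen first, so that the tail of [ln (1 + |t|)] is small,
    and the smoothing scale afterwards, so that the points of the disc where one
    of the two inequalities fails have small measure even when weighted by
    [ln (1 + N)].  On the tail, [ln (1 + N)] is at most [ln (1 + |t|)]. *)
Lemma exists_large_set (eta gamma : R) : 0 < eta -> 0 < gamma ->
  exists (E : set (borelC R)) (N k : nat), [/\ measurable E,
    (forall z : R[i], E z -> normc z <= N%:R),
    E `<=` drop_set k.+1%:R^-1 eta, E `<=` le_set k.+1%:R^-1 eta &
    fine (mu (~` E)) + (fine (mu (~` E)) * ln (1 + N%:R) +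
      \int[mu]_(t in ~` E) ln (1 + normc (t : R[i]))) <= gamma].
Proof.
move=> eta0 gamma0.
have g2 : 0 < gamma / 2 by rewrite divr_gt0.
pose lg (t : borelC R) := ln (1 + normc (t : R[i])).
have ilg D (mD : measurable D) := integrable_log_infty log_mu mD.
have icst D (c : R) (mD : measurable D) := integrable_cst mu c mD.
pose A n : set (borelC R) := [set z | normc (z : R[i]) <= n%:R].
have mA n : measurable (A n).
  by apply: measurable_le_set => //; exact: measurable_normc.
have i1 : mu.-integrable setT (EFin \o (fun t => 1 + 2 * lg t)).
  by apply: integrableD_EFin => //; [exact: icst|apply: integrableZl_EFin => //; exact: ilg].
have aeA : {ae mu, forall z, \forall n \near \oo, ~ (~` A n) z}.
  apply: aeW => z; near=> n; apply; rewrite /A /=.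
  by near: n; exact: nbhs_infty_ger.
have [N _ /(_ N (leqnn N)) /= small1] :=
  Rintegral_vanishing g2 i1 (fun n => measurableC (mA n)) aeA.
pose f t := 1 + (ln (1 + N%:R) + lg t).
have i2 D : measurable D -> mu.-integrable D (EFin \o f).
  by move=> mD; do 2![apply: integrableD_EFin => //; first exact: icst]; exact: ilg.
pose G k := drop_set k.+1%:R^-1 eta `&` le_set k.+1%:R^-1 eta.
have mG k : measurable (G k).
  apply: measurableI; [apply: measurable_drop_set|apply: measurable_le_set_potential];
  exact: invS_itv.
have aeG : {ae mu, forall z, \forall n \near \oo, ~ (A N `\` G n) z}.
  apply: (@filterS _ _ (ae_filter_ringOfSetsType mu) _ _ _ ae_le)
    => z [/potential_real[u Uz ule] le_z].
  have lt1 : (\int[mu]_t log_dist z t < (u + eta)%:E)%E by rewrite Uz lte_fin ltrDl.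
  have lt2 : (\int[nu]_t log_dist z t < (u + C + eta)%:E)%E.
    by apply: (le_lt_trans le_z); rewrite Uz lte_fin ltrDl.
  have near1 := near_spot_lt log_mu lt1; have near2 := near_spot_lt log_nu lt2.
  near=> n; move=> [_]; apply; split => k.
    have h1 : spot mu setT n.+1%:R^-1 z < u + eta by near: n; exact: near1.
    by have := ule k; move: h1; lra.
  have h2 : spot nu setT n.+1%:R^-1 z < u + C + eta by near: n; exact: near2.
  by have := ule k; move: h2; lra.
have [k _ /(_ k (leqnn k)) /= small2] :=
  Rintegral_vanishing g2 (i2 _ measurableT) (fun n => measurableD (mA N) (mG n)) aeG.
pose E := A N `&` G k.
have mE : measurable E by exact: measurableI.
have EC : ~` E = (~` A N) `|` (A N `\` G k).
  rewrite /E setCI; apply/seteqP; split => z /=; last tauto.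
  by have [] := pselect (A N z); tauto.
exists E, N, k; split => //; [by move=> z []|by move=> z [_ []]|by move=> z [_ []]|].
have mEC := measurableC mE; have mAC := measurableC (mA N).
have mAG := measurableD (mA N) (mG k).
have -> : fine (mu (~` E)) + (fine (mu (~` E)) * ln (1 + N%:R) + \int[mu]_(t in ~` E) lg t)
    = \int[mu]_(t in ~` E) f t.
  have c1 := icst _ 1 mEC; have cN := icst _ (ln (1 + N%:R)) mEC.
  have l := ilg _ mEC; have clN := integrableD_EFin mEC cN l.
  by rewrite /f RintegralD// RintegralD// !Rintegral_cst// mul1r [_ * ln _]mulrC.
rewrite {1}EC Rintegral_setU//; last 2 first.
- by rewrite -EC; exact: i2.
- by rewrite disj_set2E setDE setIA setICl set0I.
have : \int[mu]_(t in ~` A N) f t <= \int[mu]_(t in ~` A N) (1 + 2 * lg t).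
  apply: le_Rintegral => //; first exact: i2.
    exact: (@integrableS _ _ _ _ setT).
  move=> t /= /negP; rewrite -ltNge => Nt.
  have : ln (1 + N%:R) <= lg t.
    rewrite ler_ln ?posrE ?lerD2l ?(ltW Nt)// ltr_pwDl// normc_ge0//.
  by rewrite /f; lra.
move: small1 small2; lra.
Unshelve. all: by end_near. Qed.

(** For fixed [z] and [j], the comparison on the plane loses [eta] times a constant
    [T] that depends neither on [eta] nor on the sets chosen for it. *)
Lemma spot_comparison (z : R[i]) (j : nat) :
  (\int[nu]_t log_dist z t <= (spot mu setT j.+1%:R^-1 z + C)%:E)%E.
Proof.
have [M] := exists_bounded_drop.
set B := drop_set 1 M; set beta := fine (mu B) => beta0.
have i1 : 0 < (1 : R) <= 1 by rewrite ltr01 lexx.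
have mB : measurable B by exact: measurable_drop_set.
have ij := invS_itv R j; have /andP[j0 j1] := ij.
pose P := fine (mu setT) * ln (1 + normc z) +
  \int[mu]_(t in setT) ln (1 + normc (t : R[i])).
pose T := `|- ln j.+1%:R^-1 + P + 13 + 9 * M|.
have key (eta : R) : 0 < eta <= 1 ->
  (\int[nu]_t log_dist z t <= (spot mu setT j.+1%:R^-1 z + C + eta * T)%:E)%E.
  move=> /andP[eta0 eta1].
  (* With [mu (~` E) <= gamma], the mass gained, at least [eta * (beta - gamma)],
     exceeds the mass lost, because [(1 + eta) * gamma <= eta * beta / 2]. *)
  pose gamma := Num.min eta (eta * beta / 4).
  have g0 : 0 < gamma by rewrite lt_min eta0 divr_gt0// mulr_gt0.
  have geta : gamma <= eta by rewrite ge_min lexx.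
  have gb : gamma <= eta * beta / 4 by rewrite ge_min lexx orbT.
  have [E [N [k [mE EN E_drop E_le E_large]]]] := exists_large_set eta0 g0.
  have mEC := measurableC mE.
  have EC0 : 0 <= fine (mu (~` E)) by exact: fine_ge0.
  have lN : 0 <= fine (mu (~` E)) * ln (1 + N%:R).
    by rewrite mulr_ge0// ln_ge0// lerDl.
  have lI : 0 <= \int[mu]_(t in ~` E) ln (1 + normc (t : R[i])).
    by apply: Rintegral_ge0 => t _; exact: log_infty_ge0.
  have ECg : fine (mu (~` E)) <= gamma by move: E_large; lra.
  have E_large' : fine (mu (~` E)) * ln (1 + N%:R) +
      \int[mu]_(t in ~` E) ln (1 + normc (t : R[i])) <= eta.
    by move: E_large; lra.
  have mass1 := fine_measureC mu mE.
  have mass2 := fine_measure_le_setI mu mE mB.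
  have etab : eta * beta <= beta by rewrite -[leRHS]mul1r ler_pM2r.
  have nm : fine (nu setT) <= fine (mu setT) by rewrite fine_le ?fin_num_measure.
  have mass_lt : fine (nu setT) < fine (mu E) + eta * fine (mu (E `&` B)).
    have := ler_wpM2l (ltW eta0) mass2; rewrite -/beta.
    have : eta * fine (mu (~` E)) <= fine (mu (~` E)).
      by rewrite -[leRHS]mul1r ler_wpM2r.
    have : 0 < eta * beta by rewrite mulr_gt0.
    by move: nm mass1 ECg gb; lra.
  have EB0 : E `&` B !=set0.
    apply/set0P/negP => /eqP EB; move: mass2; rewrite EB measure0 /= add0r -/beta.
    by move: beta0 etab gb ECg; lra.
  have [n1 _ all_le] := comparison_everywhere log_mu log_nu mE mB eta0
    (invS_itv R k) EN (fun z n Ez => E_drop z Ez n) (fun z n Ez => E_le z Ez n)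
    (fun z n Bz => Bz n) E_large' mass_lt EB0.
  pose n := maxn n1 j.
  have := all_le n (leq_maxl _ _) z.
  have /andP[d0 d1] := invS_itv R n.
  have dj : n.+1%:R^-1 <= j.+1%:R^-1 :> R by apply: le_invS; exact: leq_maxr.
  have mEB := measurableI _ _ mE mB.
  have H1 := ler_spot log_mu z mE d0 dj j1.
  have H2 := ler_spot log_mu z mEB d0 dj j1.
  have H3 : spot mu (E `&` B) j.+1%:R^-1 z <= P.
    apply: (le_trans (spot_upper log_mu z mEB ij)); rewrite lerD//.
      rewrite ler_wpM2r ?log_infty_ge0// fine_le ?fin_num_measure//.
      by apply: le_measure; rewrite ?inE.
    have := integrable_log_infty log_mu measurableT.
    rewrite -[X in mu.-integrable X _](setUv (E `&` B)) => i.
    rewrite -(setUv (E `&` B)) Rintegral_setU//; last 2 first.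
    - exact: measurableC.
    - by rewrite disj_set2E setICr.
    by rewrite lerDl Rintegral_ge0// => t _; exact: log_infty_ge0.
  have H4 := spot_setC log_mu z mE ij.
  have H5 : fine (mu (~` E)) * ln j.+1%:R^-1 <= spot mu (~` E) j.+1%:R^-1 z.
    by apply: spot_lower => // t _; exact: ln_le_slog.
  have H6 : eta * ln j.+1%:R^-1 <= fine (mu (~` E)) * ln j.+1%:R^-1.
    by rewrite ler_wnM2r ?ln_le0// (le_trans ECg).
  have H7 := ler_wpM2l (ltW eta0) (le_trans H2 H3).
  have H8 : eta * (- ln j.+1%:R^-1 + P + 13 + 9 * M) <= eta * T.
    by rewrite ler_pM2l// ler_norm.
  move=> H0; apply: (le_trans (potential_le_spot log_nu z (invS_itv R k))).
  by rewrite lee_fin; move: H0 H1 H4 H5 H6 H7 H8; lra.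
apply/lee_addgt0Pr => e e0.
have T0 : 0 <= T by exact: normr_ge0.
have T1 : 0 < T + 1 by rewrite ltr_wpDl.
pose eta := Num.min 1 (e / (T + 1)).
have eta01 : 0 < eta <= 1 by rewrite lt_min ltr01 divr_gt0//= ge_min lexx.
apply: (le_trans (key _ eta01)); rewrite -EFinD lee_fin lerD2l.
apply: (@le_trans _ _ (e / (T + 1) * T)).
  by rewrite ler_wpM2r// ge_min lexx orbT.
by rewrite mulrAC ler_pdivrMr// ler_pM2l// lerDl.
Qed.

Lemma domination z :
  (\int[nu]_t log_dist z t <= \int[mu]_t log_dist z t + C%:E)%E.
Proof.
have lim : (spot mu setT n.+1%:R^-1 z + C)%:E @[n --> \oo] -->
    (\int[mu]_t log_dist z t + C%:E)%E.
  have U := @spot_cvg R mu log_mu z.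
  have := cvgeD _ U (cvg_cst C%:E); apply.
  by rewrite fin_num_adde_defl.
rewrite -(cvg_lim _ lim)//; apply: lime_ge.
  by apply/cvg_ex; eexists; exact: lim.
by apply: nearW => n; exact: spot_comparison.
Qed.

End domination.

Local Open Scope ereal_scope.

Theorem theorem4p10 (R : realType)
    (mu nu : {finite_measure set (borelC R) -> \bar R}) (C : R)
    (mu_gt0 : 0 < mu setT)
    (log_mu : integrates_log_at_infinity mu)
    (log_nu : integrates_log_at_infinity nu)
    (nu_le_mu : nu setT <= mu setT)
    (energy_mu : log_energy mu < +oo) :
  {ae mu, forall z, log_potential mu z <= log_potential nu z + C%:E} ->
  forall z : R[i], log_potential mu z <= log_potential nu z + C%:E.
Proof.
(* Negation exchanges the two sides without any finiteness condition, since both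
   inequalities agree for infinite values as well. *)
have swap (x y : \bar R) : (- x <= - y + C%:E) = (y <= x + C%:E).
  case: x => [x| |]; case: y => [y| |] //=; rewrite ?leey ?leNye//.
  by rewrite -!EFinD !lee_fin; apply/idP/idP => ?; lra.
move=> ae_le z; rewrite swap; apply: domination => //.
apply: (@filterS2 _ _ (ae_filter_ringOfSetsType mu) _ _ _ _
  (finite_energy_ae log_mu energy_mu) ae_le) => y Uy.
by rewrite swap.
Qed.
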